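(* Let $L>0$ and $\beta\in(0,1]$. There exist two constants $c,c'>0$ depending only on $L$ and $\beta$ such that for all integers $K\ge1$ and $n\ge2$, $$\inf_{\widetilde f}\ \sup_{f\in\mathcal{G}^\circ_{K,\beta}}\ \mathbb{P}_f\Big(\|\widetilde f-f\|_{L_1}\ge c\,\min\big\{(K/n)^{\beta/(2\beta+1)},\ n^{-\beta/(2\beta+2)}\big\}\Big)\ \ge\ c'$$ and $$\inf_{\widetilde f}\ \sup_{f\in\mathcal{G}^\circ_{K,\beta}}\ \mathbb{E}_f\|\widetilde f-f\|_{L_1}\ \ge\ c\,\min\big\{(K/n)^{\beta/(2\beta+1)},\ n^{-\beta/(2\beta+2)}\big\}.$$
   Context: For a real function $g$, $\mathrm{Supp}(g)=g^{-1}(\mathbb{R}\setminus\{0\})$. A function $g$ on $[0,1]$ is called $\beta$-Hölder (with the fixed constant $L$) if $|g(z)-g(z')|\le L|z-z'|^\beta$ for all $z,z'\in\mathrm{Supp}(g)$, i.e. the Hölder condition is only required on the support. $\mathcal{G}^\circ_{K,\beta}$ is the set of all probability densities $f$ with support exactly $[0,1]^2$ such that $$f(x,y)=\sum_{k=1}^Kw_k\,u_k(x)\,v_k(y)\qquad\text{for all }(x,y)\in[0,1]^2,$$ where $u_k,v_k$ are $\beta$-Hölder probability densities on $[0,1]$ for all $k$, and $w_k\ge0$, $\sum_{k=1}^Kw_k=1$. $\mathbb{P}_f$ and $\mathbb{E}_f$ are the probability and expectation when $X_1,\dots,X_n$ are iid with density $f$. $\inf_{\widetilde f}$ is the infimum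 over all density estimators $\widetilde f$ based on $(X_1,\dots,X_n)$. $\|\cdot\|_{L_1}$ is the norm of $L_1([0,1]^2,\mathrm{Leb})$. *)

(* Defs.v *)
From HB Require Import structures.
From mathcomp Require Import all_boot all_order all_algebra.
From mathcomp Require Import all_classical all_reals all_analysis.
From mathcomp Require Import measurable_realfun.

Set Implicit Arguments.
Unset Strict Implicit.
Unset Printing Implicit Defensive.

Import Order.TTheory GRing.Theory Num.Theory.
Import numFieldNormedType.Exports.

Local Open Scope classical_set_scope.
Local Open Scope ring_scope.

Section densities.
Local Open Scope ereal_scope.
Context d (T : measurableType d) (R : realType).
Variable mu : {measure set T -> \bar R}.

Definition is_density (f : T -> R) : Prop :=
  [/\ measurable_fun [set: T] f,
      (forall x, 0 <= f x)%R &
      \int[mu]_x (f x)%:E = 1].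

Record density := Density {
  density_fun :> T -> R;
  densityP : is_density density_fun }.

Definition density_prob (f : density) : set T -> \bar R :=
  fun A => \int[mu]_(x in A) (f x)%:E.

Variable f : density.

Let density_prob0 : density_prob f set0 = 0.
Proof. by rewrite /density_prob integral_set0. Qed.

Let density_prob_ge0 A : 0 <= density_prob f A.
Proof.
have [_ f0 _] := densityP f.
by apply: integral_ge0 => x _; rewrite lee_fin.
Qed.

Let density_prob_sigma_additive : semi_sigma_additive (density_prob f).
Proof.
have [mf f0 _] := densityP f; move=> F mF tF mUF; rewrite /density_prob /=.
rewrite ge0_integral_bigcup//=.
- by apply: is_cvg_ereal_nneg_natsum_cond => n _ _; apply: integral_ge0 => x _;
    rewrite lee_fin.
- exact/measurable_EFinP/measurable_funTS.
- by move=> x _; rewrite lee_fin.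
Qed.

HB.instance Definition _ := isMeasure.Build _ _ _ (density_prob f)
  density_prob0 density_prob_ge0 density_prob_sigma_additive.

Let density_prob_setT : density_prob f [set: T] = 1.
Proof. by have [] := densityP f. Qed.

HB.instance Definition _ := Measure_isProbability.Build _ _ _
  (density_prob f) density_prob_setT.

End densities.

Section iid_sample.
Context d (T : measurableType d) (R : realType).

Definition tuple_cons n (p : T * n.-tuple T) : n.+1.-tuple T :=
  [tuple of p.1 :: p.2].

Let measurable_tuple_cons n : measurable_fun setT (@tuple_cons n).
Proof. exact: measurable_cons. Qed.

HB.instance Definition _ n :=
  isMeasurableFun.Build _ _ _ _ (@tuple_cons n) (@measurable_tuple_cons n).

(* The n-fold product measure: the law of (X_1, ..., X_n) when the X_i are iid
   with law P. *)
Fixpoint iid_law (P : probability T R) (n : nat) :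
    probability (n.-tuple T) R :=
  match n with
  | 0 => dirac [tuple]
  | n'.+1 => distribution (P \x iid_law P n')%E (@tuple_cons n')
  end.

End iid_sample.

Section model.
Local Open Scope ereal_scope.
Context (R : realType).

Definition plane := (measurableTypeR R * measurableTypeR R)%type.

Definition lebesgue2 : {measure set plane -> \bar R} :=
  lebesgue_measure \x lebesgue_measure.

Definition unit_square : set plane := `[0%R, 1%R] `*` `[0%R, 1%R].

Definition Supp (T : Type) (g : T -> R) : set T := g @^-1` [set~ 0%R].

Definition holder_on_Supp (L beta : R) (g : R -> R) : Prop :=
  forall z z', Supp g z -> Supp g z' ->
    (`|g z - g z'| <= L * `|z - z'| `^ beta)%R.

(* Functions on [0, 1] are encoded as functions on R vanishing off [0, 1]. *)
Definition holder_density (L beta : R) (u : measurableTypeR R -> R) : Prop :=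
  [/\ is_density lebesgue_measure u,
      Supp u `<=` `[0%R, 1%R] &
      holder_on_Supp L beta u].

Definition multiview_class (K : nat) (L beta : R) : set (density lebesgue2) :=
  [set f | Supp f = unit_square /\
    exists (w : 'I_K -> R) (u v : 'I_K -> measurableTypeR R -> R),
      [/\ (forall k, 0 <= w k)%R,
          (\sum_(k < K) w k = 1)%R,
          (forall k, holder_density L beta (u k)),
          (forall k, holder_density L beta (v k)) &
          forall x y, unit_square (x, y) ->
            f (x, y) = (\sum_(k < K) w k * u k x * v k y)%R]].

(* P_f, the law of the sample (X_1, ..., X_n) *)
Definition sample_prob (n : nat) (f : density lebesgue2) :
    probability (n.-tuple plane) R :=
  iid_law (density_prob f) n.

(* The estimate computed from the sample s is estimator s : plane -> R; it is
   not required to be itself a probability density. *)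
Definition estimators (n : nat) : set (n.-tuple plane -> plane -> R) :=
  [set tf | measurable_fun [set: n.-tuple plane * plane]
              (fun p => tf p.1 p.2)].

Definition L1_dist (g h : plane -> R) : \bar R :=
  \int[lebesgue2]_(z in unit_square) `|g z - h z|%:E.

Definition minimax_prob (n : nat) (G : set (density lebesgue2)) (r : R) :
    \bar R :=
  ereal_inf [set ereal_sup
    [set sample_prob n f [set s | r%:E <= L1_dist (tf s) f] | f in G]
    | tf in @estimators n].

Definition minimax_risk (n : nat) (G : set (density lebesgue2)) : \bar R :=
  ereal_inf [set ereal_sup
    [set \int[sample_prob n f]_s L1_dist (tf s) f | f in G]
    | tf in @estimators n].

Definition rate (K n : nat) (beta : R) : R :=
  (Num.min ((K%:R / n%:R) `^ (beta / (2 * beta + 1)))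
           (n%:R `^ (- (beta / (2 * beta + 2)))))%R.

End model.

(* Main.v *)
Require Import Defs.
From HB Require Import structures.
From mathcomp Require Import all_boot all_order all_algebra.
From mathcomp Require Import all_classical all_reals all_analysis.
From mathcomp Require Import measurable_realfun ring lra.

(** The lower bound is Assouad's argument on a hypercube of densities which are
indexed by the K * m cells of a K by m grid of the unit square.

The Hölder condition bears on the support only, so a density that is constant on
a strip of width 1 / K and null elsewhere satisfies it with any constant.  The
mixture with weights 1 / K of K products, whose first factor is uniform on the
k-th vertical strip and whose second factor is v_k, is therefore the density
equal to v_k (y) at a point (x, y) of the k-th strip: a mixture of K products
can carry K unrelated univariate densities ([cube_fun], [cube_funE]).  Each v_k
is the uniform density plus m signed oscillations [wavelet] of width 1 / m and
amplitude of order a, one per horizontal cell, with integral 0.  Such a v_k is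
Hölder with constant L as soon as a * m `^ beta <= L ([ripple_lipschitz],
[profile_holder]).

Flipping one sign changes the density on a single cell of area 1 / (K m) by at
most a / 2, hence the chi-square divergence between the two densities is at most
a ^+ 2 / (2 K m).  If n times this quantity is small, no test tells the two
samples of size n apart ([two_point_bound], [cube_density_close]).  At a point
of the cell where the oscillation is large, the two densities differ by at least
a / 32 ([cube_fun_sep]), so that any estimator errs by order a for one of them.
Averaging over all sign vectors and integrating over a region of area 1 / 4 made
of such points shows that for some sign vector the L1 loss is of order a with
probability bounded below ([assouad_probability], [cube_lower_bound]).

With a of order m `^ (- beta) the condition on the divergence reads
n <= K m `^ (2 beta + 1).  Only min (K, m) of the K available components are
used.  If m is a rounding of the maximum of (n / K) `^ (1 / (2 beta + 1)) and
n `^ (1 / (2 beta + 2)), then the condition holds for this number of components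
and m `^ (- beta) is of the order of the rate ([rate_tuning]).  The bound in
expectation follows from the bound in probability by Markov's inequality. *)

Set Implicit Arguments.
Unset Strict Implicit.
Unset Printing Implicit Defensive.

Import Order.TTheory GRing.Theory Num.Theory.
Import numFieldNormedType.Exports.

Local Open Scope classical_set_scope.
Local Open Scope ring_scope.

(** * Likelihood ratios and the two-point bound *)

(** Here c is the likelihood ratio of two hypotheses, and a and b are the losses
of a procedure under each of them.  Since a + b * c is at least min (1, c), it
is at least the quadratic polynomial 2 c - c ^+ 2 - 1 / 4, whose integral only
involves the first two moments of c.  All terms are moved to the side that makes
them nonnegative, so that the inequality can be integrated term by term. *)
Lemma testing_loss_quadratic_bound (R : realType) (a b c : R) :
  0 <= a -> 0 <= b -> 0 <= c -> 1 <= a + b ->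
  2 * c <= a + b * c + c ^+ 2 + 4^-1.
Proof.
move=> a0 b0 c0 ab.
have [c1|c1] := leP 1 c.
  have : 0 <= b * (c - 1) by rewrite mulr_ge0// subr_ge0.
  have := sqr_ge0 (c - 1); nra.
have : 0 <= a * (1 - c) by rewrite mulr_ge0// subr_ge0 ltW.
have : 0 <= (a + b - 1) * c by rewrite mulr_ge0// subr_ge0.
have := sqr_ge0 (c - 2^-1); nra.
Qed.

Section likelihood_ratio.
Local Open Scope ereal_scope.
Context d (T : measurableType d) (R : realType).
Variable mu : {sigma_finite_measure set T -> \bar R}.

Lemma density_prob_dominated (p : density mu) : density_prob p `<< mu.
Proof.
have [mp p0 _] := densityP p.
apply/null_content_dominatesP => A mA muA0.
rewrite /density_prob; apply/eqP; rewrite eq_le integral_ge0 ?andbT; last first.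
  by move=> x _; rewrite lee_fin.
have ->// : \int[mu]_(x in A) (p x)%:E = 0.
apply: null_set_integral => //.
exact/measurable_EFinP/measurable_funTS.
Qed.

(** By uniqueness of the Radon-Nikodym derivative, the density is the derivative
almost everywhere. *)
Lemma integral_density_prob (p : density mu) (h : T -> \bar R) :
  measurable_fun setT h -> (forall x, 0 <= h x) ->
  \int[density_prob p]_x h x = \int[mu]_x (h x * (p x)%:E).
Proof.
move=> mh h0; have [mp p0 p1] := densityP p.
have dom := density_prob_dominated p.
have ip : mu.-integrable setT (EFin \o p).
  apply/integrableP; split; first exact/measurable_EFinP.
  under eq_integral do rewrite /= ger0_norm//.
  by rewrite p1 ltry.
rewrite -(Radon_Nikodym_SigmaFinite.change_of_variables dom)//.
apply: ae_eq_integral => //.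
- apply: emeasurable_funM => //.
  exact: measurable_int (Radon_Nikodym_SigmaFinite.f_integrable dom).
- by apply: emeasurable_funM => //; exact/measurable_EFinP.
- apply: ae_eqe_mul2l; apply: integral_ae_eq => //.
  + exact: Radon_Nikodym_SigmaFinite.f_integrable.
  + exact/measurable_EFinP.
  + by move=> E _ mE; rewrite -(Radon_Nikodym_SigmaFinite.f_integral dom).
Qed.

Lemma integral_iid_lawS (P : probability T R) n
    (F : n.+1.-tuple T -> \bar R) :
  measurable_fun setT F -> (forall s, 0 <= F s) ->
  \int[iid_law P n.+1]_s F s =
  \int[P]_x \int[iid_law P n]_s F (tuple_cons (x, s)).
Proof.
move=> mF F0.
rewrite [LHS]ge0_integral_pushforward//= preimage_setT fubini_tonelli1//=.
by apply: measurableT_comp => //; exact: measurable_funP.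
Qed.

Definition likelihood (g : T -> R) n (s : n.-tuple T) : R :=
  (\prod_(x <- s) g x)%R.

Lemma measurable_likelihood (g : T -> R) n :
  measurable_fun setT g -> measurable_fun setT (@likelihood g n).
Proof.
move=> mg.
rewrite (_ : @likelihood g n =
  (fun s : n.-tuple T => \prod_(i < n) g (tnth s i))%R); last first.
  by apply/funext => s; rewrite /likelihood big_tuple.
apply: measurable_prod => i _.
by apply: measurableT_comp => //; exact: measurable_tnth.
Qed.

Lemma likelihood_ge0 (g : T -> R) n (s : n.-tuple T) :
  (forall x, 0 <= g x)%R -> (0 <= likelihood g s)%R.
Proof. by move=> g0; exact: prodr_ge0. Qed.

Lemma likelihood_cons (g : T -> R) n x (s : n.-tuple T) :
  likelihood g (tuple_cons (x, s)) = (g x * likelihood g s)%R.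
Proof. by rewrite /likelihood big_cons. Qed.

(** The likelihood is a product over independent observations, so its expectation
is the n-th power of the expectation of one factor. *)
Lemma integral_likelihood_le (P : probability T R) (g : T -> R) (C : R) n :
  measurable_fun setT g -> (forall x, 0 <= g x)%R ->
  \int[P]_x (g x)%:E <= C%:E ->
  \int[iid_law P n]_s (likelihood g s)%:E <= (C ^+ n)%:E.
Proof.
move=> mg g0 gC.
have C0 : (0 <= C)%R.
  by rewrite -lee_fin (le_trans _ gC)// integral_ge0// => x _; rewrite lee_fin.
elim: n => [|n ih].
  rewrite integral_dirac//; last first.
    by apply/measurable_EFinP; exact: measurable_likelihood.
  by rewrite diracT mul1e /likelihood big_nil.
rewrite integral_iid_lawS; last 2 first.
- by apply/measurable_EFinP; exact: measurable_likelihood.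
- by move=> s; rewrite lee_fin likelihood_ge0.
under eq_integral => x _.
  under eq_integral do rewrite likelihood_cons EFinM.
  rewrite ge0_integralZl_EFin//; last 2 first.
  - by move=> s _; rewrite lee_fin likelihood_ge0.
  - by apply/measurable_EFinP; exact: measurable_likelihood.
  over.
rewrite ge0_integralZr//=; last 3 first.
- exact/measurable_EFinP.
- by move=> x _; rewrite lee_fin.
- by apply: integral_ge0 => s _; rewrite lee_fin likelihood_ge0.
rewrite exprS EFinM; apply: lee_pmul => //.
- by apply: integral_ge0 => s _; rewrite lee_fin.
- by apply: integral_ge0 => s _; rewrite lee_fin likelihood_ge0.
Qed.

(** Change of measure for samples: peeling off one observation at a time turns the
density ratio of one observation into the likelihood ratio of the sample. *)
Lemma integral_iid_law_likelihood (p q : density mu) (g : T -> R) n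
    (F : n.-tuple T -> \bar R) :
  measurable_fun setT g -> (forall x, 0 <= g x)%R ->
  (forall x, q x = g x * p x)%R ->
  measurable_fun setT F -> (forall s, 0 <= F s) ->
  \int[iid_law (density_prob q) n]_s F s =
  \int[iid_law (density_prob p) n]_s (F s * (likelihood g s)%:E).
Proof.
move=> mg g0 qgp; elim: n F => [|n ih] F mF F0.
  rewrite !integral_dirac//.
    by rewrite /likelihood big_nil mule1.
  apply: emeasurable_funM => //.
  by apply/measurable_EFinP; exact: measurable_likelihood.
have mG : measurable_fun setT (fun s => F s * (likelihood g s)%:E).
  apply: emeasurable_funM => //.
  by apply/measurable_EFinP; exact: measurable_likelihood.
have mFc : measurable_fun setT (F \o @tuple_cons _ T n).
  by apply: measurableT_comp => //; exact: measurable_funP.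
have mGc : measurable_fun setT
    ((fun s => F s * (likelihood g s)%:E) \o @tuple_cons _ T n).
  by apply: measurableT_comp => //; exact: measurable_funP.
rewrite integral_iid_lawS// integral_iid_lawS//; last first.
  by move=> s; rewrite mule_ge0// lee_fin likelihood_ge0.
rewrite integral_density_prob; last 2 first.
- exact: (measurable_fun_fubini_tonelli_F (F \o @tuple_cons _ T n)
    mFc (fun=> F0 _)).
- by move=> x; exact: integral_ge0.
rewrite integral_density_prob; last 2 first.
- apply: (measurable_fun_fubini_tonelli_F
    ((fun s => F s * (likelihood g s)%:E) \o @tuple_cons _ T n)) => //.
  by move=> s; rewrite /= mule_ge0// lee_fin likelihood_ge0.
- move=> x; apply: integral_ge0 => s _.
  by rewrite mule_ge0// lee_fin likelihood_ge0.
have mFx x : measurable_fun setT (fun s => F (tuple_cons (x, s))).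
  exact: (measurableT_comp mFc (pair1_measurable x)).
apply: eq_integral => x _; rewrite ih//.
under [in RHS]eq_integral do rewrite likelihood_cons EFinM muleCA.
rewrite ge0_integralZl_EFin//; last 2 first.
- by move=> s _; rewrite mule_ge0// lee_fin likelihood_ge0.
- apply: emeasurable_funM => //.
  by apply/measurable_EFinP; exact: measurable_likelihood.
by rewrite qgp EFinM muleCA muleA.
Qed.

(** Le Cam's bound in chi-square form.  The expectation of the squared ratio g under
p is one plus the chi-square divergence of q from p, and these factors multiply
over the sample.  Integrating [testing_loss_quadratic_bound] against the law of
the sample under p gives 2 <= loss + 5 / 4 + 1 / 4. *)
Lemma two_point_bound (p q : density mu) (g : T -> R) (C : R) n
    (phi psi : n.-tuple T -> R) :
  measurable_fun setT g -> (forall x, 0 <= g x)%R ->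
  (forall x, q x = g x * p x)%R ->
  \int[mu]_x (g x ^+ 2 * p x)%:E <= C%:E -> (C ^+ n <= 5 / 4)%R ->
  measurable_fun setT phi -> measurable_fun setT psi ->
  (forall s, 0 <= phi s)%R -> (forall s, 0 <= psi s)%R ->
  (forall s, 1 <= phi s + psi s)%R ->
  (2^-1)%:E <= \int[iid_law (density_prob p) n]_s (phi s)%:E +
               \int[iid_law (density_prob q) n]_s (psi s)%:E.
Proof.
move=> mg g0 qgp gC Cn mphi mpsi phi0 psi0 phipsi.
have mg2 : measurable_fun setT (fun x => g x ^+ 2)%R by exact: measurable_funX.
have g20 x : (0 <= g x ^+ 2)%R by rewrite exprn_ge0.
set P := iid_law (density_prob p) n.
have int_cst (Q : probability T R) (c : R) :
    \int[iid_law Q n]_s (cst c%:E) s = c%:E.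
  rewrite integral_cst// [X in _ * X](_ : _ = 1) ?mule1//.
  exact: probability_setT.
pose G : n.-tuple T -> R := @likelihood g n.
have mG : measurable_fun setT G by exact: measurable_likelihood.
have G0 s : (0 <= G s)%R by exact: likelihood_ge0.
have intG2 : \int[P]_s (G s ^+ 2)%:E <= (5 / 4)%:E.
  have -> : (fun s => (G s ^+ 2)%:E) =
      (fun s => (likelihood (fun x => g x ^+ 2)%R s)%:E).
    by apply/funext => s; rewrite /G /likelihood prodrXl.
  apply: (@le_trans _ _ (C ^+ n)%:E); last by rewrite lee_fin.
  apply: integral_likelihood_le => //.
  by rewrite integral_density_prob//; exact/measurable_EFinP.
have intG : \int[P]_s (G s)%:E = 1.
  have := @integral_iid_law_likelihood p q g n (cst 1) mg g0 qgp.
  rewrite int_cst => /(_ (measurable_cst _) (fun=> lee01)) ->.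
  by under [RHS]eq_integral do rewrite mul1e.
rewrite (integral_iid_law_likelihood mg g0 qgp)//; last exact/measurable_EFinP.
rewrite -/G -/P.
have key : 2%:E * \int[P]_s (G s)%:E <=
    \int[P]_s (phi s)%:E + \int[P]_s ((psi s)%:E * (G s)%:E) +
    \int[P]_s (G s ^+ 2)%:E + \int[P]_s (4^-1)%:E.
  rewrite -ge0_integralZl_EFin//; last 2 first.
  - by move=> s _; rewrite lee_fin.
  - exact/measurable_EFinP.
  have mpG : measurable_fun setT (fun s => psi s * G s)%R.
    exact: measurable_funM.
  have mG2 : measurable_fun setT (fun s => G s ^+ 2)%R.
    exact: measurable_funX.
  have mD1 : measurable_fun setT (fun s => phi s + psi s * G s)%R.
    exact: measurable_funD.
  have mD2 : measurable_fun setT (fun s => phi s + psi s * G s + G s ^+ 2)%R.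
    exact: measurable_funD.
  have pG0 s : (0 <= psi s * G s)%R by rewrite mulr_ge0.
  have G20 s : (0 <= G s ^+ 2)%R by rewrite exprn_ge0.
  rewrite -ge0_integralD//; last 4 first.
  - by move=> s _; rewrite lee_fin.
  - exact/measurable_EFinP.
  - by move=> s _; rewrite -EFinM lee_fin.
  - by under eq_fun do rewrite -EFinM; exact/measurable_EFinP.
  under [X in _ <= X + _ + _]eq_integral do rewrite -EFinM -EFinD.
  rewrite -ge0_integralD//; last 4 first.
  - by move=> s _; rewrite lee_fin addr_ge0.
  - exact/measurable_EFinP.
  - by move=> s _; rewrite lee_fin.
  - exact/measurable_EFinP.
  under [X in _ <= X + _]eq_integral do rewrite -EFinD.
  rewrite -ge0_integralD//; last 2 first.
  - by move=> s _; rewrite lee_fin !addr_ge0.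
  - exact/measurable_EFinP.
  under [X in _ <= X]eq_integral do rewrite -EFinD.
  apply: ge0_le_integral => //.
  - by move=> s _; rewrite -EFinM lee_fin mulr_ge0.
  - under eq_fun do rewrite -EFinM.
    by apply/measurable_EFinP; exact: measurable_funM.
  - by apply/measurable_EFinP; exact: measurable_funD.
  - move=> s _; rewrite -EFinM lee_fin.
    exact: testing_loss_quadratic_bound.
move: key; rewrite intG mule1 int_cst.
set I := (X in _ -> _ <= X) => key.
have {}key : 2%:E <= I + (5 / 4)%:E + (4^-1)%:E.
  by apply: (le_trans key); rewrite leeD2r// leeD2l.
move: key; rewrite -addeA -EFinD -leeBlDr//.
apply: le_trans; rewrite -EFinB lee_fin; lra.
Qed.

End likelihood_ratio.

(** * Assouad's lemma *)

Lemma exists_ge_of_sum_ge (R : realType) (I : finType) (F : I -> \bar R)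
    (c : R) :
  (0 < #|I|)%N -> (forall i, (0 <= F i)%E) ->
  ((c *+ #|I|)%:E <= \sum_i F i)%E -> exists i, (c%:E <= F i)%E.
Proof.
move=> /card_gt0P[i0 _] F0 cF; apply: contrapT => /forallNP Fc.
have {}Fc i : (F i < c%:E)%E by rewrite ltNge; exact/negP/Fc.
have Ffin i : F i = (fine (F i))%:E.
  by rewrite fineK// ge0_fin_numE// (lt_trans (Fc i))// ltry.
move: cF; rewrite (eq_bigr _ (fun i _ => Ffin i)) sumEFin lee_fin leNgt.
rewrite -sumr_const => /negP; apply; apply: ltr_sum => [|i _].
  by apply/hasP; exists i0 => //; rewrite mem_index_enum.
by rewrite -lte_fin -Ffin.
Qed.

(** Summing the hypothesis over i counts every term of the sum twice, as s is a
bijection. *)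
Lemma sum_ge_of_involution (R : realType) (I : finType) (s : I -> I)
    (F : I -> \bar R) (c : R) :
  involutive s -> (forall i, (0 <= F i)%E) ->
  (forall i, ((c + c)%:E <= F i + F (s i))%E) ->
  ((c *+ #|I|)%:E <= \sum_i F i)%E.
Proof.
move=> sK F0 cF.
have : ((c *+ #|I| + c *+ #|I|)%:E <= \sum_i F i + \sum_i F i)%E.
  rewrite {2}(reindex_inj (inv_inj sK)) -big_split /= -mulrnDl.
  rewrite -sumr_const -sumEFin; exact: lee_sum.
have := @sume_ge0 _ _ F xpredT (fun i _ => F0 i) (index_enum I).
case: (\sum_i F i)%E => [x _|_ _|//]; last by rewrite leey.
by rewrite -EFinD !lee_fin; lra.
Qed.

Section assouad.
Local Open Scope ereal_scope.
Context d (T : measurableType d) (R : realType).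
Variable mu : {sigma_finite_measure set T -> \bar R}.

(** The divergence enters through the second moment C of the ratio g of q to p,
which is one plus the chi-square divergence; the bound 5 / 4 on its n-th power
is the one that the two-point bound asks for. *)
Definition chi2_close n (p q : density mu) :=
  exists (g : T -> R) (C : R),
    [/\ measurable_fun setT g, (forall x, 0 <= g x)%R,
        (forall x, q x = g x * p x)%R,
        \int[mu]_x (g x ^+ 2 * p x)%:E <= C%:E & (C ^+ n <= 5 / 4)%R].

Context (Omega : finType) (f : Omega -> density mu) (n : nat).
Variables (tf : n.-tuple T -> T -> R) (M : set T) (delta m0 : R).
Hypothesis Omega_gt0 : (0 < #|Omega|)%N.
Hypothesis mtf : measurable_fun [set: n.-tuple T * T] (fun p => tf p.1 p.2).
Hypothesis mM : measurable M.
Hypothesis delta_gt0 : (0 < delta)%R.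
Variable flip : T -> Omega -> Omega.
Hypothesis flipK : forall z, involutive (flip z).
Hypothesis flip_sep : forall z w, M z ->
  (delta <= `|f w z - f (flip z w) z|)%R.
Hypothesis flip_close : forall z w, M z ->
  chi2_close n (f w) (f (flip z w)).

Let P w := iid_law (density_prob (f w)) n.

(** The truncation at delta keeps the triangle inequality between two hypotheses
that are delta apart, and makes the loss bounded, which turns a lower bound on
its expectation into a lower bound on a probability. *)
Definition truncated_loss w (s : n.-tuple T) (z : T) : R :=
  (Num.min `|tf s z - f w z| delta * \1_M z)%R.

Let loss_ge0 w s z : (0 <= truncated_loss w s z)%R.
Proof. by rewrite mulr_ge0// le_min normr_ge0 ltW. Qed.

Let mloss w : measurable_fun [set: n.-tuple T * T]
  (fun x => (truncated_loss w x.1 x.2)%:E).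
Proof.
have [mf _ _] := densityP (f w).
apply/measurable_EFinP; apply: measurable_funM.
  apply: measurable_minr => //.
  apply: measurableT_comp => //; apply: measurable_funB => //.
  exact: measurableT_comp mf measurable_snd.
apply: (@measurableT_comp _ _ _ _ _ _ (\1_M : T -> R)) => //.
Qed.

Let mloss1 w z : measurable_fun [set: n.-tuple T]
  (fun s => (truncated_loss w s z)%:E).
Proof. exact: (measurableT_comp (mloss w) (pair2_measurable z)). Qed.

Let mloss2 w s : measurable_fun [set: T]
  (fun z => (truncated_loss w s z)%:E).
Proof. exact: (measurableT_comp (mloss w) (pair1_measurable s)). Qed.

(** At the point z the losses of the two neighbours w and flip z w add up to at
least delta, so the two-point bound applies to them divided by delta. *)
Let pair_loss z w : M z ->
  ((delta / 4 + delta / 4)%R)%:E <=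
  \int[P w]_s (truncated_loss w s z)%:E +
  \int[P (flip z w)]_s (truncated_loss (flip z w) s z)%:E.
Proof.
move=> Mz; have [g [C [mg g0 qgp gC Cn]]] := flip_close w Mz.
pose phi w' (s : n.-tuple T) := (delta^-1 * truncated_loss w' s z)%R.
have mphi w' : measurable_fun setT (phi w').
  by apply: measurable_funM => //; apply/measurable_EFinP; exact: mloss1.
have phi0 w' s : (0 <= phi w' s)%R by rewrite mulr_ge0// invr_ge0 ltW.
have phiE w' s : truncated_loss w' s z = (delta * phi w' s)%R.
  by rewrite /phi mulrA divff ?gt_eqF// mul1r.
have := two_point_bound mg g0 qgp gC Cn (mphi w) (mphi (flip z w))
  (phi0 w) (phi0 (flip z w)).
have sum1 s : (1 <= phi w s + phi (flip z w) s)%R.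
  rewrite /phi -mulrDr ler_pdivlMl// mulr1 /truncated_loss indicE mem_set//.
  rewrite !mulr1; have := flip_sep w Mz.
  rewrite (_ : (f w z - _ = (tf s z - f (flip z w) z) - (tf s z - f w z))%R);
    last by ring.
  move=> sep.
  have := le_trans sep (ler_normB _ _).
  case: (leP `|tf s z - f (flip z w) z|%R delta);
    case: (leP `|tf s z - f w z|%R delta); have := delta_gt0;
    have := normr_ge0 (tf s z - f (flip z w) z)%R;
    have := normr_ge0 (tf s z - f w z)%R; lra.
move=> /(_ sum1) half.
under eq_integral do rewrite phiE EFinM.
under [X in _ <= _ + X]eq_integral do rewrite phiE EFinM.
rewrite !ge0_integralZl_EFin//; try exact/measurable_EFinP;
  try exact: ltW; try by move=> s _; rewrite lee_fin.
rewrite -ge0_muleDr; try by apply: integral_ge0 => s _; rewrite lee_fin.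
apply: (le_trans _ (lee_wpmul2l _ half)); last by rewrite lee_fin ltW.
by rewrite -EFinM lee_fin; lra.
Qed.

(** The neighbour of w may depend on the point z, so Tonelli's theorem is used to
average over the sample and over all w before integrating over z.  At a fixed z
the map flip z pairs the hypotheses, and each pair contributes [pair_loss]. *)
Lemma assouad_expectation : m0%:E <= mu M -> exists w,
  (delta / 4 * m0)%:E <= \int[P w]_s \int[mu]_z (truncated_loss w s z)%:E.
Proof.
move=> m0M; apply: exists_ge_of_sum_ge => // [w|].
  by do 2 apply: integral_ge0 => ? _; rewrite lee_fin.
under eq_bigr => w _.
  rewrite (fubini_tonelli (fun x => (truncated_loss w x.1 x.2)%:E))//;
    last by move=> x; rewrite lee_fin.
  over.
rewrite -ge0_integral_sum//=; last 2 first.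
- move=> w; apply: (measurable_fun_fubini_tonelli_G
    (fun x => (truncated_loss w x.1 x.2)%:E)) => //.
  by move=> x; rewrite lee_fin.
- by move=> w z _; apply: integral_ge0 => s _; rewrite lee_fin.
apply: (@le_trans _ _
    (\int[mu]_z ((delta / 4 *+ #|Omega|)%:E * (\1_M z)%:E))).
  rewrite ge0_integralZl_EFin//=; last 2 first.
  - exact/measurable_EFinP.
  - by rewrite mulrn_wge0// divr_ge0// ltW.
  rewrite integral_indic// setIT -(mulrnAl (delta / 4)%R) EFinM.
  by apply: lee_wpmul2l => //; rewrite lee_fin mulrn_wge0// divr_ge0// ltW.
apply: ge0_le_integral => //=.
- move=> z _; rewrite -EFinM lee_fin mulr_ge0//.
  by rewrite mulrn_wge0// divr_ge0// ltW.
- by under eq_fun do rewrite -EFinM; apply/measurable_EFinP; exact: measurable_funM.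
- apply: emeasurable_sum => w _; apply: (measurable_fun_fubini_tonelli_G
    (fun x => (truncated_loss w x.1 x.2)%:E)) => //.
  by move=> x; rewrite lee_fin.
- move=> z _; rewrite indicE; case: (boolP (z \in M)) => [/set_mem Mz|_].
    rewrite mule1; apply: (sum_ge_of_involution (flipK z)).
      by move=> w; apply: integral_ge0 => s _; rewrite lee_fin.
    by move=> w; exact: pair_loss.
  by rewrite mule0; apply: sume_ge0 => w _; apply: integral_ge0 => s _;
    rewrite lee_fin.
Qed.

Lemma measurable_integral_loss (D : set T) (p : density mu) : measurable D ->
  measurable_fun [set: n.-tuple T]
    (fun s => \int[mu]_(z in D) `|tf s z - p z|%:E).
Proof.
move=> mD; have [mp _ _] := densityP p.
have -> : (fun s => \int[mu]_(z in D) `|tf s z - p z|%:E) =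
    fubini_F mu (fun x : n.-tuple T * T =>
      (`|tf x.1 x.2 - p x.2| * \1_D x.2)%:E).
  apply/funext => s; rewrite /fubini_F [LHS]integral_mkcond.
  by apply: eq_integral => z _ /=; rewrite epatch_indic EFinM.
apply: measurable_fun_fubini_tonelli_F.
  apply/measurable_EFinP; apply: measurable_funM.
    apply: measurableT_comp => //; apply: measurable_funB => //.
    exact: measurableT_comp mp measurable_snd.
  apply: (@measurableT_comp _ _ _ _ _ _ (\1_D : T -> R)) => //.
by move=> x; rewrite lee_fin mulr_ge0.
Qed.

(** With r equal to half of the lower bound on the expected truncated loss, this
loss is at most delta on the event that the true loss is at least r, and at most
r elsewhere; hence the event has probability at least r / delta. *)
Lemma assouad_probability (D : set T) : measurable D -> M `<=` D ->
  mu M <= 1 -> (0 <= m0)%R -> m0%:E <= mu M -> exists w,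
  (m0 / 8)%:E <= P w [set s | (delta * m0 / 8)%:E <=
                              \int[mu]_(z in D) `|tf s z - f w z|%:E].
Proof.
move=> mD MD M1 m00 m0M; have [w Dw] := assouad_expectation m0M; exists w.
set A := [set s | _].
have mA : measurable A.
  rewrite -[A]setTI; apply: emeasurable_fun_c_infty => //.
  exact: measurable_integral_loss.
have lossM s : \int[mu]_z (truncated_loss w s z)%:E <= delta%:E.
  apply: (@le_trans _ _ (\int[mu]_z (delta%:E * (\1_M z)%:E))).
    apply: ge0_le_integral => //.
    - by move=> z _; rewrite lee_fin.
    - by under eq_fun do rewrite -EFinM; apply/measurable_EFinP;
        exact: measurable_funM.
    - by move=> z _; rewrite -EFinM lee_fin ler_wpM2r// ge_min lexx orbT.
  rewrite ge0_integralZl_EFin//=; last 2 first.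
  - exact/measurable_EFinP.
  - exact: ltW.
  rewrite integral_indic// setIT -[leRHS]mule1.
  by apply: lee_wpmul2l => //; rewrite lee_fin ltW.
have lossD s : \int[mu]_z (truncated_loss w s z)%:E <=
    \int[mu]_(z in D) `|tf s z - f w z|%:E.
  rewrite [leRHS]integral_mkcond.
  have [mf _ _] := densityP (f w).
  apply: ge0_le_integral => //.
  - by move=> z _; rewrite lee_fin.
  - apply/(measurable_restrictT _ mD); apply/measurable_funTS/measurable_EFinP.
    apply: measurableT_comp => //; apply: measurable_funB => //.
    exact: (measurableT_comp mtf (pair1_measurable s)).
  - move=> z _; rewrite epatch_indic/= -EFinM lee_fin.
    apply: ler_pM => //; first by rewrite le_min normr_ge0 ltW.
      by rewrite ge_min lexx.
    rewrite !indicE; case: (boolP (z \in M)) => [/set_mem/MD/mem_set ->//|_].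
    by case: (_ \in _).
have PA_fin : P w A \is a fin_num by exact: fin_num_measure.
have : \int[P w]_s \int[mu]_z (truncated_loss w s z)%:E <=
    \int[P w]_s (delta * \1_A s + delta * m0 / 8)%:E.
  apply: ge0_le_integral => //.
  - by move=> s _; apply: integral_ge0 => z _; rewrite lee_fin.
  - apply: (measurable_fun_fubini_tonelli_F
      (fun x => (truncated_loss w x.1 x.2)%:E)) => //.
    by move=> x; rewrite lee_fin.
  - apply/measurable_EFinP; apply: measurable_funD => //.
    exact: measurable_funM.
  - move=> s _; rewrite indicE; case: (boolP (s \in A)) => sA.
      apply: (le_trans (lossM s)); rewrite lee_fin mulr1 lerDl.
      by rewrite divr_ge0// mulr_ge0// ltW.
    rewrite mulr0 add0r; apply: (le_trans (lossD s)); apply: ltW.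
    by rewrite ltNge; apply: contra sA => sA; rewrite inE.
have -> : \int[P w]_s (delta * \1_A s + delta * m0 / 8)%:E =
    delta%:E * P w A + (delta * m0 / 8)%:E.
  under eq_integral do rewrite EFinD EFinM.
  rewrite ge0_integralD//; last 3 first.
  - by move=> s _; rewrite -EFinM lee_fin mulr_ge0// ltW.
  - by under eq_fun do rewrite -EFinM; apply/measurable_EFinP;
      exact: measurable_funM.
  - by move=> s _; rewrite lee_fin divr_ge0// mulr_ge0// ltW.
  rewrite ge0_integralZl_EFin//=; last 2 first.
  - exact/measurable_EFinP.
  - exact: ltW.
  rewrite integral_indic// setIT integral_cst// [X in _ + _ * X](_ : _ = 1).
    by rewrite mule1.
  exact: probability_setT.
move=> /(le_trans Dw).
rewrite -[P w A]fineK// -EFinM -EFinD !lee_fin => h.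
rewrite -(ler_pM2l delta_gt0); move: (fine _) h => x; lra.
Qed.

End assouad.

(** * Mixtures of products, and a grid of the unit interval *)

Section products_and_mixtures.
Context (R : realType).
Implicit Types u v : measurableTypeR R -> R.

Lemma is_density_product u v :
  is_density lebesgue_measure u -> is_density lebesgue_measure v ->
  is_density (@lebesgue2 R) (fun z => u z.1 * v z.2).
Proof.
move=> [mu u0 u1] [mv v0 v1].
have muv : measurable_fun setT (fun z : plane R => u z.1 * v z.2).
  apply: measurable_funM.
    exact: measurableT_comp mu measurable_fst.
  exact: measurableT_comp mv measurable_snd.
split => // [z|]; first by rewrite mulr_ge0.
rewrite fubini_tonelli1 /fubini_F/=; last 2 first.
- exact/measurable_EFinP.
- by move=> z; rewrite lee_fin mulr_ge0.
under eq_integral => x _.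
  under eq_integral do rewrite EFinM.
  rewrite ge0_integralZl_EFin//; last 2 first.
  - by move=> y _; rewrite lee_fin.
  - exact/measurable_EFinP.
  rewrite v1 mule1; over.
exact: u1.
Qed.

Lemma is_density_mixture d (T : measurableType d)
    (mu : {measure set T -> \bar R}) (K : nat) (w : 'I_K -> R)
    (f : 'I_K -> T -> R) :
  (forall k, 0 <= w k) -> \sum_(k < K) w k = 1 ->
  (forall k, is_density mu (f k)) ->
  is_density mu (fun z => \sum_(k < K) w k * f k z).
Proof.
move=> w0 w1 df.
have mf k : measurable_fun setT (f k) by have [] := df k.
have f0 k z : 0 <= f k z by have [_ /(_ z)] := df k.
have f1 k : (\int[mu]_z (f k z)%:E = 1)%E by have [] := df k.
split.
- by apply: measurable_sum => k; exact: measurable_funM.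
- by move=> z; apply: sumr_ge0 => k _; rewrite mulr_ge0.
under eq_integral do rewrite -sumEFin.
rewrite ge0_integral_sum//; last 2 first.
- by move=> k; apply/measurable_EFinP; exact: measurable_funM.
- by move=> k z _; rewrite lee_fin mulr_ge0.
rewrite (eq_bigr (fun k => (w k)%:E)) => [|k _].
  by rewrite sumEFin w1.
under eq_integral do rewrite EFinM.
rewrite ge0_integralZl_EFin//; last 2 first.
- by move=> z _; rewrite lee_fin.
- exact/measurable_EFinP.
by rewrite f1 mule1.
Qed.

End products_and_mixtures.

Section multiview_classes.
Context (R : realType) (L beta : R).

(** Supplementary components are given weight 0. *)
Lemma multiview_class_mono (K K' : nat) : (0 < K)%N -> (K <= K')%N ->
  multiview_class K L beta `<=` multiview_class K' L beta.
Proof.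
case: K => // K _ KK' f [Suppf [w [u [v [w0 w1 hu hv fE]]]]]; split => //.
pose w' (k : 'I_K') := if (k < K.+1)%N then w (inord k) else 0.
have widen (F : 'I_K.+1 -> R) :
    \sum_(k < K') (if (k < K.+1)%N then F (inord k) else 0) = \sum_k F k.
  rewrite -big_mkcond /= -(big_ord_widen K' (fun i => F (inord i)) KK').
  by apply: eq_bigr => k _; rewrite inord_val.
exists w', (fun k => u (inord k)), (fun k => v (inord k)); split => //.
- by move=> k; rewrite /w'; case: ifP.
- by rewrite /w' widen.
- move=> x y xy; rewrite fE// -widen; apply: eq_bigr => k _.
  by rewrite /w'; case: ifP => // _; rewrite !mul0r.
Qed.

End multiview_classes.

Section cells.
Context (R : realType).
Implicit Types (m j : nat) (y : R).

(** The cells are closed, so that they cover the closed unit interval; they overlap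
at the points of the grid, where the oscillations below vanish. *)
Definition cell m j : set (measurableTypeR R) :=
  `[j%:R / m%:R, j.+1%:R / m%:R].

Lemma cellP m j y : (0 < m)%N -> cell m j y <-> j%:R <= m%:R * y <= j.+1%:R.
Proof.
move=> m0; rewrite /cell /= in_itv /= ler_pdivrMr ?ltr0n// ler_pdivlMr ?ltr0n//.
by rewrite mulrC.
Qed.

Lemma measurable_cell m j : measurable (cell m j).
Proof. exact: measurable_itv. Qed.

Lemma lebesgue_measure_cell m j : (0 < m)%N ->
  lebesgue_measure (cell m j) = (m%:R^-1)%:E.
Proof.
move=> m0; rewrite /cell lebesgue_measure_itv/= lte_fin.
rewrite ltr_pM2r ?invr_gt0 ?ltr0n// ltr_nat ltnSn -EFinB -mulrBl.
by rewrite -natrB// subSnn mul1r.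
Qed.

Lemma cell_sub01 m j : (j < m)%N -> cell m j `<=` `[0%R, 1%R].
Proof.
move=> jm y /cellP; have m0 : (0 < m)%N by exact: leq_ltn_trans jm.
move=> /(_ m0) /andP[jy yj]; rewrite /= in_itv/=.
have mR : 0 < m%:R :> R by rewrite ltr0n.
rewrite -(pmulr_rge0 _ mR) (le_trans _ jy) ?ler0n//=.
by rewrite -(ler_pM2l mR) mulr1 (le_trans yj)// ler_nat.
Qed.

Lemma cell_cover m y : (0 < m)%N -> 0 <= y <= 1 ->
  exists j : 'I_m, cell m j y.
Proof.
case: m => // m _ /andP[y0 y1].
have my0 : 0 <= m.+1%:R * y by rewrite mulr_ge0.
have /andP[tr1 tr2] := truncn_itv my0.
have [tm|mt] := ltnP (Num.truncn (m.+1%:R * y)) m.+1.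
  by exists (Ordinal tm); apply/cellP => //; rewrite tr1 ltW.
exists ord_max; apply/cellP => //=.
rewrite (_ : m.+1%:R * y = m.+1%:R); first by rewrite !ler_nat leqnSn leqnn.
apply/eqP; rewrite eq_le (le_trans _ tr1) ?ler_nat// andbT.
by rewrite ler_piMr.
Qed.

End cells.

(** * Strips and oscillations *)

Section strips.
Context (R : realType).

Definition strip_density (K k : nat) : measurableTypeR R -> R :=
  fun x => K%:R * \1_(cell K k) x.

Lemma Supp_strip_density K k : (0 < K)%N ->
  Supp (strip_density K k) = cell K k.
Proof.
move=> K0; apply/seteqP; split => x; rewrite /Supp /strip_density /= indicE.
  by case: (boolP (x \in _)) => [/set_mem//|_]; rewrite mulr0.
by move=> /mem_set ->; rewrite mulr1; apply/eqP; rewrite pnatr_eq0 -lt0n.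
Qed.

(** A density that is constant on its support satisfies the Hölder condition with
any constant, since the jumps at the ends of the strip are not seen. *)
Lemma holder_strip_density (L beta : R) K k : 0 < L -> (k < K)%N ->
  holder_density L beta (strip_density K k).
Proof.
move=> L0 kK; have K0 : (0 < K)%N by exact: leq_ltn_trans kK.
have mcell : measurable (@cell R K k) by exact: measurable_cell.
split.
- split.
  + by apply: measurable_funM => //; exact: measurable_indic.
  + by move=> x; rewrite mulr_ge0.
  under eq_integral do rewrite EFinM.
  rewrite ge0_integralZl_EFin//=; last exact/measurable_EFinP.
  rewrite integral_indic// setIT [X in (_ * X)%E](@lebesgue_measure_cell R)//.
  by rewrite -EFinM divff// pnatr_eq0 -lt0n.
- by rewrite Supp_strip_density//; exact: cell_sub01.
- move=> z z'; rewrite Supp_strip_density// /strip_density !indicE.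
  move=> /mem_set -> /mem_set ->; rewrite subrr normr0.
  by rewrite mulr_ge0// ?ltW// powR_ge0.
Qed.

End strips.

Section wave.
Context (R : realType).
Implicit Types s t y : R.

(** This cubic is the simplest function that vanishes at 0 and 1 and is odd about
1 / 2, hence of integral 0; being 1-Lipschitz, it can be glued continuously at
the ends of the cells. *)
Definition wave t : R := t * (1 - t) * (1 - 2 * t).

Lemma wave_lipschitz s t : 0 <= s <= 1 -> 0 <= t <= 1 ->
  `|wave s - wave t| <= `|s - t|.
Proof.
move=> /andP[s0 s1] /andP[t0 t1].
have -> : wave s - wave t =
    (s - t) * (1 - 3 * (s + t) + 2 * (s ^+ 2 + s * t + t ^+ 2)).
  by rewrite /wave; ring.
rewrite normrM ler_piMr// ler_norml; apply/andP; split.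
  have := sqr_ge0 (s + t - 1); have := mulr_ge0 s0 t0.
  have := sqr_ge0 (s - t); nra.
have : 0 <= s * (1 - s) by rewrite mulr_ge0// subr_ge0.
have : 0 <= t * (1 - t) by rewrite mulr_ge0// subr_ge0.
have : 0 <= s * (1 - t) by rewrite mulr_ge0// subr_ge0.
have : 0 <= t * (1 - s) by rewrite mulr_ge0// subr_ge0.
nra.
Qed.

Lemma wave0 : wave 0 = 0. Proof. by rewrite /wave !mul0r. Qed.

Lemma wave1 : wave 1 = 0. Proof. by rewrite /wave subrr mulr0 mul0r. Qed.

Lemma wave_le_dist0 t : 0 <= t <= 1 -> `|wave t| <= t.
Proof.
move=> t01; have := @wave_lipschitz t 0 t01.
rewrite wave0 !subr0 lexx ler01 => /(_ isT).
by case/andP: t01 => t0 _; rewrite (ger0_norm t0).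
Qed.

Lemma wave_le_dist1 t : 0 <= t <= 1 -> `|wave t| <= 1 - t.
Proof.
move=> t01; have := @wave_lipschitz t 1 t01.
rewrite wave1 !subr0 lexx ler01 => /(_ isT).
by case/andP: t01 => _ t1; rewrite distrC (@ger0_norm _ (1 - t)) ?subr_ge0.
Qed.

Lemma wave_le t : 0 <= t <= 1 -> `|wave t| <= 4^-1.
Proof.
move=> /andP[t0 t1]; rewrite /wave normrM.
have h : 0 <= t * (1 - t) by rewrite mulr_ge0// subr_ge0.
rewrite (ger0_norm h) (@le_trans _ _ (t * (1 - t)))//.
  by rewrite ler_piMr// ler_norml; lra.
have := sqr_ge0 (t - 2^-1); nra.
Qed.

(** On this interval t * (1 - t) is at least 3 / 32 and 1 - 2 t at least 1 / 4. *)
Lemma wave_core_ge t : 1 / 8 <= t <= 3 / 8 -> 64^-1 <= `|wave t|.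
Proof.
move=> /andP[t0 t1]; apply: le_trans (ler_norm _); rewrite /wave.
have h : 3 / 32 <= t * (1 - t).
  have : 0 <= (t - 1 / 8) * (7 / 8 - t) by apply: mulr_ge0; lra.
  nra.
have h2 : 1 / 4 <= 1 - 2 * t by lra.
have : 0 <= (t * (1 - t) - 3 / 32) * (1 - 2 * t - 1 / 4).
  by apply: mulr_ge0; lra.
nra.
Qed.

Definition wavelet (m j : nat) (y : measurableTypeR R) : R :=
  wave (m%:R * y - j%:R) * \1_(cell m j) y.

Lemma wavelet_arg m j y : (0 < m)%N -> cell m j y ->
  0 <= m%:R * y - j%:R <= 1.
Proof.
move=> m0 /cellP => /(_ m0) /andP[jy yj].
by rewrite subr_ge0 jy lerBlDl -natr1 in yj *.
Qed.

Lemma wavelet_cell m j y : cell m j y -> wavelet m j y = wave (m%:R * y - j%:R).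
Proof. by move=> yj; rewrite /wavelet indicE mem_set// mulr1. Qed.

Lemma wavelet_out m j y : ~ cell m j y -> wavelet m j y = 0.
Proof. by move=> yj; rewrite /wavelet indicE memNset// mulr0. Qed.

Lemma wavelet_le m j y : (0 < m)%N -> `|wavelet m j y| <= 4^-1.
Proof.
move=> m0; have [yj|yj] := pselect (cell m j y).
  by rewrite wavelet_cell// wave_le// wavelet_arg.
by rewrite wavelet_out// normr0 invr_ge0.
Qed.

Lemma wavelet_other_cell m i j y : (0 < m)%N -> i != j -> cell m j y ->
  wavelet m i y = 0.
Proof.
move=> m0 ij yj; have [yi|/wavelet_out//] := pselect (cell m i y).
rewrite wavelet_cell//; move: yi yj => /cellP => /(_ m0) /andP[iy yi].
move=> /cellP => /(_ m0) /andP[jy yj].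
move: ij; rewrite neq_ltn => /orP[ij|ji].
  have -> : m%:R * y = i.+1%:R.
    by apply/eqP; rewrite eq_le yi (le_trans _ jy)// ler_nat.
  by rewrite -natr1 addrAC subrr add0r wave1.
have -> : m%:R * y = i%:R.
  by apply/eqP; rewrite eq_le iy (le_trans yj)// ler_nat.
by rewrite subrr wave0.
Qed.

Lemma measurable_wave m j :
  measurable_fun [set: measurableTypeR R] (fun y => wave (m%:R * y - j%:R)).
Proof.
have mid : measurable_fun [set: measurableTypeR R]
    (fun y : measurableTypeR R => m%:R * y - j%:R).
  by apply: measurable_funB => //; exact: measurable_funM.
apply: measurable_funM.
  by apply: measurable_funM => //; exact: measurable_funB.
by apply: measurable_funB => //; exact: measurable_funM.
Qed.

Lemma measurable_wavelet m j : measurable_fun setT (wavelet m j).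
Proof.
apply: measurable_funM; first exact: measurable_wave.
by apply: measurable_indic; exact: measurable_cell.
Qed.

Lemma integrable_wavelet m j : (0 < m)%N ->
  lebesgue_measure.-integrable setT (fun y => (wavelet m j y)%:E).
Proof.
move=> m0.
apply: le_integrable
  (integrable_indic_itv (j%:R / m%:R) (j.+1%:R / m%:R) true false) => //.
- by apply/measurable_EFinP; exact: measurable_wavelet.
- move=> y _; rewrite /= lee_fin indicE.
  have [yj|yj] := pselect (cell m j y).
    rewrite mem_set// normr1 (le_trans (wavelet_le _ _ m0))//.
    by rewrite invf_le1// ler1n.
  by rewrite wavelet_out// normr0.
Qed.

(** The wave is a derivative of half the square of t * (1 - t), which takes the same
value at 0 and 1. *)
Lemma integral_wavelet m j : (0 < m)%N ->
  (\int[lebesgue_measure]_y (wavelet m j y)%:E = 0)%E.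
Proof.
move=> m0; have m0R : m%:R != 0 :> R by rewrite pnatr_eq0 -lt0n.
have [q qE dq] : exists2 q : {poly R},
    forall y, q.[y] = m%:R * y - j%:R & q^`() = m%:R%:P.
  exists (m%:R *: 'X - j%:R%:P) => [y|]; first by rewrite !hornerE.
  by rewrite derivB derivZ derivX derivC subr0 alg_polyC.
(* half the square of t * (1 - t), in the variable t = m y - j *)
pose p : {poly R} := (2 * m%:R)^-1 *: ((q * (1 - q)) * (q * (1 - q))).
have pE y : p^`().[y] = wave (m%:R * y - j%:R).
  rewrite /p derivZ !derivM derivB dq -polyC1 derivC sub0r.
  by rewrite !(hornerZ, hornerD, hornerM, hornerN, hornerC, qE) /wave; field.
have -> : (fun y => (wavelet m j y)%:E) =
    ((fun y => (p^`().[y])%:E) \_ (cell m j))%E.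
  by apply/funext => y; rewrite epatch_indic pE -EFinM.
rewrite -integral_mkcond /cell (@continuous_FTC2 _ _ (horner p)).
- rewrite -EFinB /p !(hornerZ, hornerD, hornerM, hornerN, hornerC, qE) -natr1.
  by congr (_%:E); field.
- by rewrite ltr_pM2r ?invr_gt0 ?ltr0n// ltr_nat.
- by apply: continuous_subspaceT; exact: continuous_horner.
- split.
  + by move=> y _; exact: derivable_horner.
  + exact/cvg_at_right_filter/continuous_horner.
  + exact/cvg_at_left_filter/continuous_horner.
- by move=> y _; rewrite derivE.
Qed.

End wave.

(** * Univariate densities with signed oscillations *)

Section profiles.
Context (R : realType) (m : nat).
Hypothesis m_gt0 : (0 < m)%N.
Implicit Types (a t : R) (y : measurableTypeR R) (sg : 'I_m -> bool).

Definition ripple sg y : R := \sum_(j < m) (-1) ^+ sg j * wavelet m j y.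

Definition profile a sg y : R := \1_`[0, 1] y + a * ripple sg y.

Lemma ripple_cell sg (j : 'I_m) y : cell m j y ->
  ripple sg y = (-1) ^+ sg j * wave (m%:R * y - j%:R).
Proof.
move=> yj; rewrite /ripple (bigD1 j)//= big1 ?addr0 ?wavelet_cell// => i ij.
by rewrite (wavelet_other_cell _ _ yj) ?mulr0.
Qed.

Lemma ripple_le sg y : `|ripple sg y| <= 4^-1.
Proof.
have [[j yj]|nc] := pselect (exists j : 'I_m, cell m j y).
  by rewrite (ripple_cell _ yj) normrMsign wave_le//
    wavelet_arg.
rewrite /ripple big1 ?normr0 ?invr_ge0// => j _.
by rewrite wavelet_out ?mulr0// => yj; apply: nc; exists j.
Qed.

Lemma ripple_out sg y : ~ (0 <= y <= 1) -> ripple sg y = 0.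
Proof.
move=> y01; rewrite /ripple big1// => j _; rewrite wavelet_out ?mulr0// => yj.
by apply: y01; have := cell_sub01 (ltn_ord j) yj; rewrite /= in_itv.
Qed.

(** Within a cell this is the Lipschitz property of the wave.  For two points of
different cells, the value at each is bounded by its distance to the end of its
cell that faces the other point, where the wave vanishes. *)
Lemma ripple_lipschitz sg y y' : 0 <= y <= 1 -> 0 <= y' <= 1 ->
  `|ripple sg y - ripple sg y'| <= m%:R * `|y - y'|.
Proof.
wlog yy' : y y' / y <= y' => [wl|] y01 y'01.
  have [yy'|/ltW y'y] := leP y y'; first exact: wl.
  by rewrite distrC (distrC y); exact: wl.
have [i yi] := cell_cover m_gt0 y01; have [j yj] := cell_cover m_gt0 y'01.
have si := wavelet_arg m_gt0 yi; have sj := wavelet_arg m_gt0 yj.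
rewrite (ripple_cell _ yi) (ripple_cell _ yj).
have -> : m%:R * `|y - y'| = `|m%:R * y - m%:R * y'|.
  by rewrite -mulrBr normrM normr_nat.
have myy' : m%:R * y <= m%:R * y' by rewrite ler_wpM2l.
have [ij|ij] := eqVneq i j.
  rewrite -{j yj}ij in sj *; rewrite -mulrBr normrMsign.
  by rewrite (le_trans (wave_lipschitz si sj))// opprB addrA subrK.
apply: (le_trans (ler_normB _ _)); rewrite !normrMsign.
rewrite [leRHS]distrC [leRHS]ger0_norm ?subr_ge0//.
have [ji|ij'] := ltnP j i.
  apply: (le_trans (lerD (wave_le_dist0 si) (wave_le_dist1 sj))).
  have : j.+1%:R <= i%:R :> R by rewrite ler_nat.
  by rewrite -natr1; lra.
apply: (le_trans (lerD (wave_le_dist1 si) (wave_le_dist0 sj))).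
have : i.+1%:R <= j%:R :> R by rewrite ler_nat ltn_neqAle ij.
by rewrite -natr1; lra.
Qed.

(** Up to distance 1 / m, the Lipschitz bound is stronger than the Hölder bound
because beta <= 1; beyond it, the uniform bound 1 / 4 on the oscillations
suffices. *)
Lemma profile_holder a sg (L beta : R) :
  0 <= a -> 0 < beta <= 1 -> a * m%:R `^ beta <= L ->
  forall y y', 0 <= y <= 1 -> 0 <= y' <= 1 ->
  `|profile a sg y - profile a sg y'| <= L * `|y - y'| `^ beta.
Proof.
move=> a0 /andP[b0 b1] aL y y' y01 y'01.
have in01 (z : R) : 0 <= z <= 1 -> z \in `[0, 1]%classic by rewrite inE/= in_itv.
rewrite /profile !indicE !in01//.
rewrite [X in `|X|](_ : _ = a * (ripple sg y - ripple sg y')); last by ring.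
rewrite normrM (ger0_norm a0).
apply: (@le_trans _ _ (a * (m%:R * `|y - y'|) `^ beta)); last first.
  by rewrite powRM// mulrA ler_wpM2r// powR_ge0.
rewrite ler_wpM2l//; have rl := ripple_lipschitz sg y01 y'01.
have mn0 : 0 <= m%:R * `|y - y'| by rewrite mulr_ge0.
have [small|large] := leP (m%:R * `|y - y'|) 1.
  apply: (le_trans rl); move: mn0; rewrite le_eqVlt => /predU1P[<-|mn0].
    exact: powR_ge0.
  by rewrite -[leLHS](powRr1 (ltW mn0)) ger_powR// mn0.
apply: (@le_trans _ _ (2^-1)).
  rewrite (le_trans (ler_normB _ _))// (le_trans (lerD (ripple_le _ _) (ripple_le _ _)))//.
  lra.
apply: (@le_trans _ _ 1); first by rewrite invf_le1// ler1n.
have := @ge0_ler_powR _ _ (ltW b0) 1 (m%:R * `|y - y'|).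
by rewrite powR1; apply; rewrite ?nnegrE//; exact: ltW.
Qed.

Lemma profile_ge a sg y : 0 <= a <= 1 -> 0 <= y <= 1 ->
  3 / 4 <= profile a sg y.
Proof.
move=> /andP[a0 a1] y01; rewrite /profile indicE mem_set ?/= ?in_itv//=.
have := ripple_le sg y; rewrite ler_norml => /andP[h _].
have : a * (- 4^-1) <= a * ripple sg y by rewrite ler_wpM2l.
lra.
Qed.

Lemma profile_out a sg y : ~ (0 <= y <= 1) -> profile a sg y = 0.
Proof.
by move=> y01; rewrite /profile ripple_out// mulr0 addr0 indicE memNset//=.
Qed.

Lemma profile_ge0 a sg y : 0 <= a <= 1 -> 0 <= profile a sg y.
Proof.
move=> a01; have [y01|y01] := boolP (0 <= y <= 1).
  by apply: le_trans (profile_ge sg a01 y01); rewrite divr_ge0.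
by rewrite profile_out//; exact/negP.
Qed.

Lemma Supp_profile a sg : 0 <= a <= 1 ->
  Supp (profile a sg) = `[0, 1]%classic.
Proof.
move=> a01; apply/seteqP; split => y; rewrite /Supp /= in_itv/=.
  by move=> p0; apply: contrapT => y01; apply: p0; exact: profile_out.
by move=> y01; apply/eqP; rewrite gt_eqF// (lt_le_trans _ (profile_ge _ a01 y01)).
Qed.

(** The oscillations have integral 0, so they do not change the total mass. *)
Lemma is_density_profile a sg : 0 <= a <= 1 ->
  is_density lebesgue_measure (profile a sg).
Proof.
move=> a01.
have mripple : measurable_fun setT (ripple sg).
  apply: measurable_sum => j; apply: measurable_funM => //.
  exact: measurable_wavelet.
split.
- apply: measurable_funD; last exact: measurable_funM.
  by apply: measurable_indic; exact: measurable_itv.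
- by move=> y; exact: profile_ge0.
have iwavelet (j : 'I_m) : lebesgue_measure.-integrable setT
    (fun y => (a * (-1) ^+ sg j)%:E * (wavelet m j y)%:E)%E.
  by apply: integrableZl => //; exact: integrable_wavelet.
rewrite (_ : (fun y => (profile a sg y)%:E) = (fun y => (\1_`[0, 1] y)%:E +
    \sum_(j < m) (a * (-1) ^+ sg j)%:E * (wavelet m j y)%:E)%E); last first.
  apply/funext => y; rewrite /profile EFinD; congr (_ + _)%E.
  rewrite /ripple mulr_sumr -sumEFin; apply: eq_bigr => j _.
  by rewrite mulrA.
rewrite integralD//; last 2 first.
- exact: (integrable_indic_itv 0 1 true false).
- by apply: integrable_sum.
rewrite integral_sum// big1 ?adde0 => [|j _].
  rewrite integral_indic// setIT [LHS](@lebesgue_measure_itv R `[0, 1])/=.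
  by rewrite lte01 oppr0 adde0.
rewrite integralZl//; last exact: integrable_wavelet.
by rewrite integral_wavelet// mule0.
Qed.

Lemma holder_profile a sg (L beta : R) :
  0 <= a <= 1 -> 0 < beta <= 1 -> a * m%:R `^ beta <= L ->
  holder_density L beta (profile a sg).
Proof.
move=> a01 beta01 aL; split; first exact: is_density_profile.
  by rewrite Supp_profile.
move=> y y'; rewrite !Supp_profile// /= !in_itv/= => y01 y'01.
by apply: profile_holder => //; case/andP: a01.
Qed.

End profiles.

(** * The hypercube of densities *)

Lemma lebesgue2X (R : realType) (A B : set (measurableTypeR R)) :
  measurable A -> measurable B ->
  lebesgue2 R (A `*` B) = (lebesgue_measure A * lebesgue_measure B)%E.
Proof. by move=> mA mB; rewrite /lebesgue2/= product_measure1E. Qed.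

Lemma sigma_finite_lebesgue2 (R : realType) : sigma_finite setT (lebesgue2 R).
Proof.
pose I n : set (measurableTypeR R) := `[- n%:R, n%:R]%classic.
have mI n : measurable (I n) by exact: measurable_itv.
exists (fun n => I n `*` I n).
  apply/seteqP; split => // -[x y] _.
  exists (Num.truncn (`|x| + `|y|)).+1 => //.
  have lt : `|x| + `|y| < (Num.truncn (`|x| + `|y|)).+1%:R.
    by have /andP[] := truncn_itv (addr_ge0 (normr_ge0 x) (normr_ge0 y)).
  split; rewrite /I /= in_itv/= -ler_norml (le_trans _ (ltW lt))//.
    by rewrite lerDl.
  by rewrite lerDr.
move=> n; split; first exact: measurableX.
rewrite lebesgue2X// lebesgue_measure_itv/=.
by case: ifP => _; rewrite ?mule0// -EFinD -EFinM ltry.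
Qed.

(** This is lebesgue2 together with its sigma-finiteness, which Tonelli's theorem
asks for; as measures the two are convertible. *)
Definition plane_measure R : {sigma_finite_measure set (plane R) -> \bar R} :=
  HB.pack (Measure.sort (lebesgue2 R)) (Measure_isSigmaFinite.Build _ (plane R) R (lebesgue2 R) (sigma_finite_lebesgue2 R)).
(** By Bernoulli's inequality in the form (1 + x) ^+ n * (1 - n x) <= 1. *)
Lemma expr1D_le (R : realType) (x : R) n : 0 <= x -> n%:R * x <= 1 / 5 ->
  (1 + x) ^+ n <= 5 / 4.
Proof.
move=> x0 nx.
have bernoulli : (1 + x) ^+ n * (1 - n%:R * x) <= 1.
  elim: n {nx} => [|n ih]; first by rewrite expr0 mul0r subr0 mulr1.
  apply: le_trans ih; rewrite exprSr -mulrA ler_wpM2l ?exprn_ge0 ?addr_ge0//.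
  by rewrite -natr1; have := ler0n R n; nra.
have : 0 <= (1 + x) ^+ n * (1 / 5 - n%:R * x).
  by apply: mulr_ge0; [rewrite exprn_ge0// addr_ge0 | rewrite subr_ge0].
by move: ((1 + x) ^+ n) bernoulli => X; lra.
Qed.

Section hypercube.
Context (R : realType) (L beta a : R) (K m : nat).
Hypothesis (K_gt0 : (0 < K)%N) (m_gt0 : (0 < m)%N).
Hypothesis a01 : 0 <= a <= 1.
Let cube := {ffun 'I_K * 'I_m -> bool}.
Implicit Types (w : cube) (c : 'I_K * 'I_m) (z : plane R).

Definition cube_fun w z : R :=
  \sum_(k < K) K%:R^-1 *
    (strip_density K k z.1 * profile a (fun j => w (k, j)) z.2).

Let KR_neq0 : K%:R != 0 :> R. Proof. by rewrite pnatr_eq0 -lt0n. Qed.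

(** The weight 1 / K cancels the height K of the strips: on the k-th strip the
mixture is the k-th univariate density. *)
Lemma cube_funE w z :
  cube_fun w z =
  \sum_(k < K) \1_(cell K k) z.1 * profile a (fun j => w (k, j)) z.2.
Proof.
apply: eq_bigr => k _; rewrite /strip_density !mulrA mulVf ?mul1r//.
Qed.

Lemma weights_sum1 : \sum_(k < K) K%:R^-1 = 1 :> R.
Proof. by rewrite sumr_const card_ord -[LHS]mulr_natr mulVf. Qed.

Lemma is_density_cube_fun w : is_density (@lebesgue2 R) (cube_fun w).
Proof.
apply: is_density_mixture => [k||k]; first by rewrite invr_ge0.
  exact: weights_sum1.
apply: (@is_density_product R (strip_density K k)).
  by have [] := holder_strip_density (1 : R) (@ltr01 R) (ltn_ord k).
exact: is_density_profile.
Qed.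

Definition cube_density w : density (@lebesgue2 R) :=
  Density (is_density_cube_fun w).

(** A point of the square lies in some strip, whose component alone is at least
3 / 4; the other components are nonnegative. *)
Lemma cube_fun_ge w z : unit_square z -> 3 / 4 <= cube_fun w z.
Proof.
rewrite /unit_square /= !in_itv/= => -[x01 y01].
have [k xk] := cell_cover K_gt0 x01.
rewrite cube_funE (bigD1 k)//= indicE mem_set// mul1r -[leLHS]addr0.
apply: lerD; first exact: profile_ge.
by apply: sumr_ge0 => i _; rewrite mulr_ge0// profile_ge0.
Qed.

Lemma cube_fun_out w z : ~ unit_square z -> cube_fun w z = 0.
Proof.
move=> zsq; rewrite cube_funE big1// => k _.
have [xk|xk] := pselect (cell K k z.1); last by rewrite indicE memNset// mul0r.
rewrite profile_out ?mulr0// => y01; apply: zsq; split.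
  exact: (cell_sub01 (ltn_ord k) xk).
by rewrite /= in_itv.
Qed.

Lemma cube_density_multiview w : 0 < L -> 0 < beta <= 1 ->
  a * m%:R `^ beta <= L -> multiview_class K L beta (cube_density w).
Proof.
move=> L0 beta01 aL; split.
  apply/seteqP; split => z; rewrite /Supp /=.
    by move=> fz; apply: contrapT => zsq; apply: fz; exact: cube_fun_out.
  move=> zsq; apply/eqP; rewrite gt_eqF// (lt_le_trans _ (cube_fun_ge w zsq))//.
exists (fun=> K%:R^-1), (fun k => strip_density K k),
  (fun k => profile a (fun j => w (k, j))); split.
- by move=> k; rewrite invr_ge0.
- exact: weights_sum1.
- by move=> k; exact: holder_strip_density.
- by move=> k; exact: holder_profile.
- by move=> x y _; apply: eq_bigr => k _; rewrite mulrA.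
Qed.

Definition toggle c w : cube := [ffun c' => w c' (+) (c' == c)].

Lemma toggleK c : involutive (toggle c).
Proof. by move=> w; apply/ffunP => c'; rewrite !ffunE addbK. Qed.

(** Changing one sign changes only one oscillation of one univariate density. *)
Lemma cube_fun_toggle c w z :
  cube_fun (toggle c w) z - cube_fun w z =
  - (2 * a * (-1) ^+ w c) * (\1_(cell K c.1) z.1 * wavelet m c.2 z.2).
Proof.
case: c => k j; rewrite !cube_funE -sumrB (bigD1 k)//= big1 ?addr0; last first.
  move=> i ik; rewrite -mulrBr (_ : profile _ _ _ - _ = 0) ?mulr0//.
  apply/eqP; rewrite subr_eq0; apply/eqP; congr (profile _ _ _).
  apply/funext => j'; rewrite ffunE xpair_eqE (negbTE ik) andFb addbF//.
rewrite -mulrBr mulrCA; congr (_ * _).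
rewrite /profile opprD addrACA subrr add0r -mulrBr /ripple -sumrB.
rewrite (bigD1 j)//= big1 ?addr0 => [|i ij].
  by rewrite ffunE eqxx addbT; case: (w (k, j)); rewrite /=; ring.
by rewrite ffunE xpair_eqE eqxx (negbTE ij) andbF addbF subrr.
Qed.

Lemma cube_fun_toggle_sqr_le c w z :
  (cube_fun (toggle c w) z - cube_fun w z) ^+ 2 <=
  a ^+ 2 / 4 * \1_(cell K c.1 `*` cell m c.2) z.
Proof.
rewrite cube_fun_toggle exprMn sqrrN exprMn sqrr_sign mulr1 !indicE.
have [zc|zc] := pselect ((cell K c.1 `*` cell m c.2) z); last first.
  rewrite [_ \in _ `*` _]memNset// mulr0.
  have [z1|z1] := pselect (cell K c.1 z.1); last first.
    by rewrite memNset// mul0r expr0n mulr0.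
  by rewrite wavelet_out ?mulr0 ?expr0n ?mulr0// => z2; exact: zc.
rewrite (mem_set zc) mem_set; last by case: zc.
rewrite mul1r mulr1.
have := wavelet_le c.2 z.2 m_gt0; rewrite -ler_sqr ?nnegrE ?invr_ge0//.
rewrite real_normK ?num_real// => h.
rewrite (_ : a ^+ 2 / 4 = (2 * a) ^+ 2 * 4^-1 ^+ 2); last by field.
by rewrite ler_wpM2l ?sqr_ge0.
Qed.

(** The ratio q / p has second moment one plus the integral of (q - p) ^+ 2 / p.
As p is at least 3 / 4 on the square and q - p is at most a / 2 and null outside
of one cell of area 1 / (K m), this integral is at most a ^+ 2 / (2 K m). *)
Lemma cube_density_close n c w : n%:R * (a ^+ 2 / (2 * (K * m)%:R)) <= 1 / 5 ->
  @chi2_close _ (plane R) R (plane_measure R) n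
    (cube_density w) (cube_density (toggle c w)).
Proof.
move=> na.
have [mp p0 p1] := is_density_cube_fun w.
have [mq q0 q1] := is_density_cube_fun (toggle c w).
have := cube_fun_toggle_sqr_le c w; have := cube_fun_ge w.
have := cube_fun_out w; have := cube_fun_out (toggle c w).
rewrite /chi2_close/=; set p := cube_fun w in mp p0 p1 *.
set q := cube_fun (toggle c w) in mq q0 q1 * => qout pout pge qp.
pose g z := q z * p z `^ (-1).
have gE z : g z = q z / p z by rewrite /g powR_inv1.
have mg : measurable_fun [set: plane R] g.
  apply: measurable_funM => //.
  exact: (measurableT_comp (measurable_powR _)).
have g0 z : 0 <= g z by rewrite mulr_ge0// powR_ge0.
have qgp z : q z = g z * p z.
  rewrite gE; have [zsq|zsq] := pselect (unit_square z).
    rewrite divfK// gt_eqF// (lt_le_trans _ (pge _ zsq))//.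
  by rewrite qout// !mul0r.
exists g, (1 + a ^+ 2 / (2 * (K * m)%:R)); split => //; last first.
  by apply: expr1D_le => //; rewrite divr_ge0 ?sqr_ge0 ?mulr_ge0.
set rect := cell K c.1 `*` cell m c.2 in qp.
have mrect : measurable rect by apply: measurableX; exact: measurable_cell.
have mg2p : measurable_fun setT (fun z => g z ^+ 2 * p z).
  by apply: measurable_funM => //; exact: measurable_funX.
have g2p0 z : 0 <= g z ^+ 2 * p z by rewrite mulr_ge0// exprn_ge0.
have pointwise z : g z ^+ 2 * p z + p z <= 2 * q z + a ^+ 2 / 2 * \1_rect z.
  have [zsq|zsq] := pselect (unit_square z); last first.
    by rewrite pout// mulr0 addr0 qout// mulr0 add0r mulr_ge0 ?divr_ge0 ?sqr_ge0.
  have pz := pge _ zsq; have pz0 : 0 < p z by exact: lt_le_trans pz.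
  rewrite -lerBlDl (_ : _ - _ = (q z - p z) ^+ 2 / p z); last first.
    by rewrite gE; field; rewrite gt_eqF.
  rewrite ler_pdivrMr// (le_trans (qp z))// indicE.
  have : 0 <= a ^+ 2 * (p z - 3 / 4).
    by apply: mulr_ge0; [exact: sqr_ge0 | rewrite subr_ge0].
  by case: (_ \in _); rewrite /= ?mulr1 ?mulr0 ?mul0r//;
    have := sqr_ge0 a; move: (a ^+ 2) (p z) => A B; lra.
have int_le : (\int[plane_measure R]_z (g z ^+ 2 * p z)%:E + 1 <=
    2%:E + (a ^+ 2 / (2 * (K * m)%:R))%:E)%E.
  rewrite -{1}p1 -ge0_integralD//=; last 4 first.
  - by move=> z _; rewrite lee_fin.
  - exact/measurable_EFinP.
  - by move=> z _; rewrite lee_fin.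
  - exact/measurable_EFinP.
  apply: (@le_trans _ _ (\int[plane_measure R]_z
      (2%:E * (q z)%:E + (a ^+ 2 / 2)%:E * (\1_rect z)%:E))%E).
    apply: ge0_le_integral => //.
    - by move=> z _; rewrite lee_fin addr_ge0.
    - by apply/measurable_EFinP; exact: measurable_funD.
    - apply: emeasurable_funD.
        by apply/measurable_EFinP; exact: measurable_funM.
      by apply/measurable_EFinP; exact: measurable_funM.
    - by move=> z _; rewrite -!EFinM -EFinD lee_fin.
  rewrite ge0_integralD//; last 4 first.
  - by move=> z _; rewrite -EFinM lee_fin mulr_ge0.
  - by apply/measurable_EFinP; exact: measurable_funM.
  - by move=> z _; rewrite -EFinM lee_fin mulr_ge0 ?divr_ge0 ?sqr_ge0.
  - by apply/measurable_EFinP; exact: measurable_funM.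
  rewrite !ge0_integralZl_EFin//=; try exact/measurable_EFinP;
    try by rewrite divr_ge0 ?sqr_ge0.
  2: by move=> z _; rewrite lee_fin.
  rewrite [X in (_ * X + _)%E]q1 mule1 integral_indic// setIT.
  rewrite [X in (_ * X)%E]lebesgue2X; try exact: measurable_cell.
  rewrite !lebesgue_measure_cell// -!EFinM -!EFinD lee_fin natrM invfM.
  rewrite le_eqVlt; apply/orP; left; apply/eqP; field.
  by rewrite !pnatr_eq0 -!lt0n K_gt0 m_gt0.
move: int_le; rewrite -leeBrDr//; move/le_trans; apply.
by rewrite -EFinD lee_fin; lra.
Qed.

(** A part of the first half of a cell, on which the wave is at least 1 / 64. *)
Definition core (j : nat) : set (measurableTypeR R) :=
  `[(j%:R + 1 / 8) / m%:R, (j%:R + 3 / 8) / m%:R]%classic.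

Definition core_region : set (plane R) :=
  `[0, 1]%classic `*` \big[setU/set0]_(j < m) core j.

Let mR_gt0 : 0 < m%:R :> R. Proof. by rewrite ltr0n. Qed.

Lemma coreP j y :
  core j y -> 1 / 8 <= m%:R * y - j%:R <= 3 / 8.
Proof.
rewrite /core /= in_itv/= ler_pdivrMr// ler_pdivlMr// mulrC => /andP[? ?].
by apply/andP; split; lra.
Qed.

Lemma core_sub_cell j : core j `<=` cell m j.
Proof.
move=> y /coreP h; apply/cellP => //; rewrite -natr1.
by case/andP: h => ? ?; apply/andP; split; lra.
Qed.

Lemma measurable_core j : measurable (core j).
Proof. exact: measurable_itv. Qed.

Lemma trivIset_core : trivIset [set: 'I_m] core.
Proof.
move=> i j _ _ [y [/coreP/andP[yi1 yi2] /coreP/andP[yj1 yj2]]].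
apply/val_inj/eqP; rewrite eqn_leq -(ltnS i) -(ltnS j) -!(ltr_nat R).
rewrite -(natr1 i) -(natr1 j).
by apply/andP; split; lra.
Qed.

Lemma measurable_core_region : measurable core_region.
Proof.
apply: measurableX; first exact: measurable_itv.
by apply: bigsetU_measurable => j _; exact: measurable_core.
Qed.

(** The m disjoint cores have length 1 / (4 m) each. *)
Lemma plane_measure_core_region : plane_measure R core_region = (4^-1)%:E.
Proof.
rewrite [LHS]lebesgue2X; last 2 first.
- exact: measurable_itv.
- by apply: bigsetU_measurable => j _; exact: measurable_core.
rewrite [X in (X * _)%E](@lebesgue_measure_itv R `[0, 1])/= lte01.
rewrite oppr0 adde0 mul1e.
rewrite measure_bigsetU_ord//; last 2 first.
- by move=> j; exact: measurable_core.
- exact: trivIset_core.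
rewrite (eq_bigr (fun=> ((4 * m%:R)^-1)%:E)) => [|j _].
  rewrite sumEFin sumr_const card_ord -[X in X%:E]mulr_natr; congr _%:E.
  by field; rewrite gt_eqF.
rewrite [LHS](@lebesgue_measure_itv R `[_, _])/= lte_fin ltr_pM2r ?invr_gt0//.
rewrite ltrD2l ifT; last by lra.
by rewrite -EFinB; congr _%:E; field; rewrite gt_eqF.
Qed.

Lemma core_regionP z : core_region z ->
  exists c, cell K c.1 z.1 /\ core c.2 z.2.
Proof.
move=> [/=]; rewrite in_itv/= => x01.
rewrite -(bigcup_mkord m core) => -[j /= jm yj].
have [k xk] := cell_cover K_gt0 x01.
by exists (k, Ordinal jm).
Qed.

Lemma core_region_sub : core_region `<=` @unit_square R.
Proof.
move=> z zM; have [c [_ yc]] := core_regionP zM; split; first by case: zM.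
exact: (cell_sub01 (ltn_ord c.2) (core_sub_cell yc)).
Qed.

Lemma cube_fun_sep c w z : cell K c.1 z.1 -> core c.2 z.2 ->
  a / 32 <= `|cube_fun w z - cube_fun (toggle c w) z|.
Proof.
move=> zk zj; rewrite distrC cube_fun_toggle mulNr normrN.
rewrite (mulrC (2 * a)) -(mulrA ((-1) ^+ w c)) normrMsign normrM.
rewrite indicE mem_set// mul1r wavelet_cell; last exact: core_sub_cell.
have := wave_core_ge (coreP zj); case/andP: a01 => a0 _.
rewrite (ger0_norm (mulr_ge0 _ a0))// => h.
have : 0 <= a * (`|wave (m%:R * z.2 - c.2%:R)| - 64^-1).
  by rewrite mulr_ge0// subr_ge0.
by move: `|_| h => X h; lra.
Qed.

End hypercube.

(** * The choice of the resolution, and the lower bound *)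

Section tuning.
Context (R : realType).

Lemma rate_gt0 (K n : nat) (beta : R) :
  (0 < K)%N -> (0 < n)%N -> 0 < rate K n beta.
Proof.
by move=> K0 n0; rewrite /rate lt_min !powR_gt0 ?divr_gt0 ?ltr0n.
Qed.

(** Let x be the maximum of (n / K) `^ (1 / (2 beta + 1)) and
n `^ (1 / (2 beta + 2)), so that the rate is at most x `^ (- beta).  The integer m
lies between x and 2 x.  The first term of the maximum gives
n <= K m `^ (2 beta + 1) and the second one n <= m m `^ (2 beta + 1), whence the
number min (K, m) of components. *)
Lemma rate_tuning (K n : nat) (beta : R) :
  0 < beta <= 1 -> (0 < K)%N -> (0 < n)%N ->
  exists m K' : nat, [/\ (0 < m)%N, (0 < K' <= K)%N,
    n%:R <= K'%:R * m%:R * (m%:R `^ beta) ^+ 2 &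
    rate K n beta <= 2 / m%:R `^ beta].
Proof.
move=> /andP[b0 b1] K0 n0.
have KR : 0 < K%:R :> R by rewrite ltr0n.
have nR : 0 < n%:R :> R by rewrite ltr0n.
have nK : 0 <= n%:R / K%:R :> R by rewrite divr_ge0.
have b1_gt0 : 0 < 2 * beta + 1 by rewrite addr_gt0// mulr_gt0.
have b2_gt0 : 0 < 2 * beta + 2 by rewrite addr_gt0// mulr_gt0.
pose x1 := (n%:R / K%:R) `^ (2 * beta + 1)^-1.
pose x2 := n%:R `^ (2 * beta + 2)^-1.
pose x := Num.max x1 x2.
have x1E : x1 `^ (2 * beta + 1) = n%:R / K%:R.
  by rewrite /x1 -powRrM mulVf ?gt_eqF// powRr1.
have x2E : x2 `^ (2 * beta + 2) = n%:R.
  by rewrite /x2 -powRrM mulVf ?gt_eqF// powRr1// ltW.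
have x10 : 0 < x1 by rewrite powR_gt0// divr_gt0.
have x21 : 1 <= x2.
  have := @ge0_ler_powR R (2 * beta + 2)^-1 _ 1 n%:R.
  by rewrite powR1; apply; rewrite ?nnegrE ?ler1n// invr_ge0 ltW.
have x_ge1 : 1 <= x by rewrite le_max x21 orbT.
have x_gt0 : 0 < x by exact: lt_le_trans x_ge1.
pose m := (Num.truncn x).+1.
have /andP[mx xm] := truncn_itv (ltW x_gt0); rewrite -/m in xm.
have m2x : m%:R <= 2 * x by rewrite /m -natr1; lra.
have mR : 0 < m%:R :> R by rewrite ltr0n.
have mb : m%:R * (m%:R `^ beta) ^+ 2 = m%:R `^ (2 * beta + 1).
  rewrite powRD; last by rewrite (gt_eqF mR) implybT.
  by rewrite powRr1 ?ltW// mulrC (mulrC 2) powRrM powR_mulrn ?powR_ge0.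
have nKm : n%:R <= K%:R * m%:R `^ (2 * beta + 1).
  rewrite mulrC -ler_pdivrMr// -x1E ge0_ler_powR ?nnegrE ?ltW//.
  by rewrite (le_lt_trans _ xm)// le_max lexx.
have nmm : n%:R <= m%:R * m%:R `^ (2 * beta + 1).
  rewrite [X in X * _](_ : _ = m%:R `^ 1); last by rewrite powRr1// ltW.
  rewrite -powRD; last by rewrite (gt_eqF mR) implybT.
  rewrite -x2E (_ : 1 + (2 * beta + 1) = 2 * beta + 2); last by ring.
  rewrite ge0_ler_powR ?nnegrE ?ltW// ?powR_gt0//.
  by rewrite (le_lt_trans _ xm)// le_max lexx orbT.
exists m, (minn K m); split => //.
- by rewrite leq_min K0 geq_minl.
- by rewrite -mulrA mb /minn; case: ifP.
have rx : rate K n beta <= (x `^ beta)^-1.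
  rewrite /x; case: (leP x1 x2) => _.
    rewrite /rate ge_min; apply/orP; right.
    by rewrite /x2 -powRrM (mulrC (2 * beta + 2)^-1) powRN.
  rewrite /rate ge_min; apply/orP; left.
  rewrite /x1 -powRrM (mulrC (2 * beta + 1)^-1) -[K%:R / _]invf_div -(powR_inv1 nK).
  by rewrite -powRrM mulN1r powRN.
apply: (le_trans rx); rewrite ler_pdivlMr ?powR_gt0// mulrC.
rewrite ler_pdivrMr ?powR_gt0//.
apply: (@le_trans _ _ ((2 * x) `^ beta)).
  by rewrite ge0_ler_powR ?nnegrE ?mulr_ge0 ?(ltW b0) ?(ltW mR) ?(ltW x_gt0).
rewrite powRM ?(ltW x_gt0)// ler_wpM2r ?powR_ge0//.
by rewrite -[leRHS]powRr1// ler_powR// ler1n.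
Qed.

End tuning.

Section lower_bound.
Context (R : realType) (L beta : R).
Hypothesis (L_gt0 : (0 < L)) (beta01 : (0 < beta <= 1)).

Lemma measurable_L1_dist n (tf : n.-tuple (plane R) -> plane R -> R)
    (f : density (lebesgue2 R)) :
  @estimators R n tf -> measurable_fun setT (fun s => L1_dist (tf s) f).
Proof.
move=> mtf; apply: (@measurable_integral_loss _ (plane R) R (plane_measure R)).
  exact: mtf.
by apply: measurableX; exact: measurable_itv.
Qed.

Lemma measurable_loss_ge n (tf : n.-tuple (plane R) -> plane R -> R)
    (f : density (lebesgue2 R)) (r : R) :
  @estimators R n tf -> measurable [set s | (r%:E <= L1_dist (tf s) f)%E].
Proof.
move=> mtf; rewrite -[X in measurable X]setTI.
by apply: emeasurable_fun_c_infty => //; exact: measurable_L1_dist.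
Qed.

(** At each point of the core region the sign to flip is the one attached to a cell
of the grid that contains the point. *)
Lemma cube_lower_bound (K m n : nat) (a : R)
    (tf : n.-tuple (plane R) -> plane R -> R) :
  (0 < K)%N -> (0 < m)%N -> (0 < a <= 1) -> (a * m%:R `^ beta <= L) ->
  (n%:R * (a ^+ 2 / (2 * (K * m)%:R)) <= 1 / 5) ->
  @estimators R n tf ->
  exists2 f, multiview_class K L beta f &
    ((32^-1)%:E <=
      sample_prob n f [set s | ((a / 1024)%:E <= L1_dist (tf s) f)%E])%E.
Proof.
move=> K0 m0 /andP[a0 a1] aL na mtf.
have a01 : (0 <= a <= 1) by rewrite ltW.
pose Q (z : plane R) c := cell K (c : 'I_K * 'I_m).1 z.1 /\ @core R m c.2 z.2.
pose flip z (w : {ffun 'I_K * 'I_m -> bool}) :=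
  if pselect (exists c, Q z c) is left ex then toggle (projT1 (cid ex)) w
  else w.
have flipP z w : core_region m z ->
    exists c, Q z c /\ flip z w = toggle c w.
  move=> /(core_regionP K0) ex; rewrite /flip; case: pselect => // ex'.
  by case: cid => c Qc; exists c.
have flipK z : involutive (flip z).
  by move=> w; rewrite /flip; case: pselect => // ex; rewrite toggleK.
have close z w : core_region m z ->
    @chi2_close _ (plane R) R (plane_measure R) n
      (cube_density K0 m0 a01 w) (cube_density K0 m0 a01 (flip z w)).
  by move=> /(flipP z w)[c [_ ->]]; exact: cube_density_close.
have sep z w : core_region m z -> (a / 32 <=
    `|cube_density K0 m0 a01 w z - cube_density K0 m0 a01 (flip z w) z|).
  by move=> /(flipP z w)[c [[zk zj] ->]]; exact: cube_fun_sep.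
have cube_gt0 : (0 < #|{ffun 'I_K * 'I_m -> bool}|)%N.
  by rewrite card_ffun card_bool expn_gt0.
have D_gt0 : (0 < a / 32) by rewrite divr_gt0.
have [|||||w Pw] := @assouad_probability _ (plane R) R (plane_measure R) _
  (cube_density K0 m0 a01) n tf (core_region m) (a / 32) 4^-1 cube_gt0 mtf
  (@measurable_core_region R m) D_gt0 flip flipK sep close (@unit_square R).
- by apply: measurableX; exact: measurable_itv.
- exact: (core_region_sub K0 m0).
- by rewrite plane_measure_core_region// lee_fin invf_le1// ler1n.
- by [].
- by rewrite plane_measure_core_region.
exists (cube_density K0 m0 a01 w); first exact: cube_density_multiview.
have -> : (32^-1 = 4^-1 / 8 :> R) by field.
have -> : (a / 1024 = a / 32 * 4^-1 / 8) by field.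
exact: Pw.
Qed.

(** The amplitude is a = l / m `^ beta with l = min (L, 1 / 2): l <= L gives the
Hölder constant, and l <= 1 / 2 bounds n times the divergence by
l ^+ 2 / 2 <= 1 / 8. *)
Lemma estimator_lower_bound : exists2 c : R, (0 < c) &
  forall (K n : nat) (tf : n.-tuple (plane R) -> plane R -> R),
    (0 < K)%N -> (0 < n)%N -> @estimators R n tf ->
    exists2 f, multiview_class K L beta f &
      ((32^-1)%:E <= sample_prob n f
        [set s | ((c * rate K n beta)%:E <= L1_dist (tf s) f)%E])%E.
Proof.
pose l : R := (Num.min L 2^-1).
have l0 : (0 < l) by rewrite /l lt_min L_gt0 invr_gt0 ltr0n.
have lL : (l <= L) by rewrite /l ge_min lexx.
have l2 : (l <= 2^-1) by rewrite /l ge_min lexx orbT.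
have c_gt0 : (0 < l / 2048) by apply: divr_gt0; rewrite ?ltr0n.
exists (l / 2048) => [//|K n tf K0 n0 mtf].
have [m [K' [m0 /andP[K'0 K'K] nK'm rm]]] := rate_tuning beta01 K0 n0.
set M := (m%:R `^ beta) in nK'm rm.
have mR : (0 < m%:R :> R) by rewrite ltr0n.
have K'R : (0 < K'%:R :> R) by rewrite ltr0n.
have M1 : (1 <= M).
  have [b0 _] := andP beta01.
  have := @ge0_ler_powR R beta (ltW b0) 1 m%:R.
  by rewrite powR1; apply; rewrite ?nnegrE ?ler1n.
have M0 : (0 < M) by exact: lt_le_trans M1.
have [|||f Ff Pf] := @cube_lower_bound K' m n (l / M) tf K'0 m0 _ _ _ mtf.
- rewrite divr_gt0//= ler_pdivrMr// mul1r (le_trans l2)// (le_trans _ M1)//.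
  by rewrite invf_le1// ler1n.
- by rewrite divfK// gt_eqF.
- apply: (@le_trans _ _ (K'%:R * m%:R * M ^+ 2 *
      ((l / M) ^+ 2 / (2 * (K' * m)%:R)))).
    by rewrite ler_wpM2r// divr_ge0// sqr_ge0.
  rewrite (_ : (_ * _ = l ^+ 2 / 2)); last first.
    by rewrite natrM; field; rewrite !gt_eqF.
  have : (l * l <= 2^-1 * 2^-1) by rewrite ler_pM// ltW.
  by rewrite expr2; lra.
exists f; first exact: (multiview_class_mono K'0 K'K).
apply: (le_trans Pf); apply: le_measure; rewrite ?inE.
- exact: measurable_loss_ge.
- exact: measurable_loss_ge.
- move=> s /=; apply: le_trans; rewrite lee_fin.
  apply: (@le_trans _ _ (l / 2048 * (2 / M))).
    by rewrite (ler_wpM2l (ltW c_gt0)).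
  by rewrite le_eqVlt; apply/orP; left; apply/eqP; field; rewrite gt_eqF.
Qed.

End lower_bound.

Theorem theorem6 (R : realType) (L beta : R)
    (hL : (0 < L)%R) (hbeta0 : (0 < beta)%R) (hbeta1 : (beta <= 1)%R) :
  exists c c' : R, [/\ (0 < c)%R, (0 < c')%R &
    forall K n : nat, (1 <= K)%N -> (2 <= n)%N ->
      (c'%:E <= minimax_prob n (multiview_class K L beta)
                  (c * rate K n beta)%R)%E /\
      ((c * rate K n beta)%:E <=
         minimax_risk n (multiview_class K L beta))%E].
Proof.
have beta01 : 0 < beta <= 1 by rewrite hbeta0.
have [c c0 hc] := estimator_lower_bound hL beta01.
exists (c / 32), 32^-1; split; rewrite ?divr_gt0 ?invr_gt0// => K n K1 n2.
have n1 : (0 < n)%N by exact: ltnW.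
have cr0 : 0 < c * rate K n beta by rewrite mulr_gt0 ?rate_gt0.
split; apply: le_ereal_inf_tmp => _ [tf mtf <-];
  have [f Ff Pf] := hc K n tf K1 n1 mtf.
  apply: (le_trans _ (ereal_sup_ubound _)); last by exists f.
  apply: (le_trans Pf); apply: le_measure; rewrite ?inE;
    try exact: measurable_loss_ge.
  move=> s /=; apply: le_trans; rewrite lee_fin mulrAC.
  by rewrite ler_pdivrMr// ler_peMr ?ler1n// ltW.
apply: (le_trans _ (ereal_sup_ubound _)); last by exists f.
have : ((c * rate K n beta)%:E * sample_prob n f
    [set s | ((c * rate K n beta)%:E <= L1_dist (tf s) f)%E] <=
    \int[sample_prob n f]_s L1_dist (tf s) f)%E.
  have L1_ge0 s : (0 <= L1_dist (tf s) f)%E.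
    by apply: integral_ge0 => z _; rewrite lee_fin.
  have absE s : `|L1_dist (tf s) f|%E = L1_dist (tf s) f by rewrite gee0_abs.
  have := @le_integral_abse _ _ _ (sample_prob n f) _ measurableT _ _
    (measurable_L1_dist f mtf) cr0.
  rewrite setTI (_ : [set s | _] =
    [set s | ((c * rate K n beta)%:E <= L1_dist (tf s) f)%E]).
    by under [X in (_ <= X)%E]eq_integral do rewrite absE.
  by apply/seteqP; split => s /=; rewrite absE.
apply: le_trans; rewrite mulrAC EFinM.
by rewrite lee_wpmul2l// lee_fin ltW.
Qed.
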